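(* Let $\mathcal X,\mathcal Y$ be real infinite-dimensional separable Hilbert spaces, $\gamma=\mathcal N(0,C_{\mathcal X})$ a centered nondegenerate Gaussian measure on $\mathcal X$ with Cameron--Martin space $\mathcal E$, and let $r\in\mathbb N$. Let $F\in H^1_\gamma$ and assume that $(C_{\mathcal X}^{-1}v_i^{\mathrm{DIS}})_{i=1}^\infty$ and $(C_{\mathcal X}^{-1}\widehat v_i^{\mathrm{DIS}})_{i=1}^\infty$ are well-defined in $\mathcal X$. Then the projections onto the exact derivative-informed subspaces minimize the derivative reconstruction errors: $$\mathbb E_\gamma\big[\|D_{\mathcal E}F(I-Q_r^{\mathrm{DIS}})\|^2_{\mathrm{HS}(\mathcal E,\mathcal Y)}\big]=\min_{Q_r\in\mathcal P_r(\mathcal E)}\mathbb E_\gamma\big[\|D_{\mathcal E}F(I-Q_r)\|^2_{\mathrm{HS}(\mathcal E,\mathcal Y)}\big]=\sum_{i=r+1}^\infty\mu_i^{\mathrm{DIS}},$$ $$\mathbb E_\gamma\big[\|(I-P_r^{\mathrm{DIS}})D_{\mathcal E}F\|^2_{\mathrm{HS}(\mathcal E,\mathcal Y)}\big]=\min_{P_r\in\mathcal P_r(\mathcal Y)}\mathbb E_\gamma\big[\|(I-P_r)D_{\mathcal E}F\|^2_{\mathrm{HS}(\mathcal E,\mathcal Y)}\big]=\sum_{i=r+1}^\infty\lambda_i^{\mathrm{DIS}}.$$ Moreover, for the empirical derivative-informed subspaces, $$\mathbb E_\gamma\big[\|D_{\mathcal E}F(I-\widehat Q_r^{\mathrm{DIS}})\|^2_{\mathrm{HS}(\mathcal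 E,\mathcal Y)}\big]\le\sum_{i=r+1}^\infty\mu_i^{\mathrm{DIS}}+\min\Big\{\sqrt{2r}\,\|H_{\mathcal X}-\widehat H_{\mathcal X}\|_{\mathrm{HS}(\mathcal E,\mathcal E)},\frac{2\|H_{\mathcal X}-\widehat H_{\mathcal X}\|^2_{\mathrm{HS}(\mathcal E,\mathcal E)}}{\mu_r^{\mathrm{DIS}}-\mu_{r+1}^{\mathrm{DIS}}}\Big\},$$ $$\mathbb E_\gamma\big[\|(I-\widehat P_r^{\mathrm{DIS}})D_{\mathcal E}F\|^2_{\mathrm{HS}(\mathcal E,\mathcal Y)}\big]\le\sum_{i=r+1}^\infty\lambda_i^{\mathrm{DIS}}+\min\Big\{\sqrt{2r}\,\|H_{\mathcal Y}-\widehat H_{\mathcal Y}\|_{\mathrm{HS}(\mathcal Y,\mathcal Y)},\frac{2\|H_{\mathcal Y}-\widehat H_{\mathcal Y}\|^2_{\mathrm{HS}(\mathcal Y,\mathcal Y)}}{\lambda_r^{\mathrm{DIS}}-\lambda_{r+1}^{\mathrm{DIS}}}\Big\}.$$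
   Context: Setting. $C_{\mathcal X}$ is trace class and injective. $\mathcal E=\mathrm{Range}(C_{\mathcal X}^{1/2})$ with $\langle w_1,w_2\rangle_{\mathcal E}=\langle C_{\mathcal X}^{-1/2}w_1,C_{\mathcal X}^{-1/2}w_2\rangle_{\mathcal X}$. ''$C_{\mathcal X}^{-1}v$ well-defined in $\mathcal X$'' means $v\in\mathrm{Range}(C_{\mathcal X})$. $\mathrm{HS}$ denotes Hilbert--Schmidt operators/norm. $\mathcal P_r(\mathcal H)$ is the set of rank-$r$ orthogonal projections on $\mathcal H$. Sobolev space. $\mathcal{FC}^\infty$ is the set of $F(x)=\sum_{i=1}^{M}\phi_i(\langle w_1,x\rangle_{\mathcal X},\dots,\langle w_n,x\rangle_{\mathcal X})y_i$ with $w_j\in\mathcal X$, $y_i\in\mathcal Y$, $\phi_i\in C_b^\infty(\mathbb R^n)$ (bounded together with all derivatives); $D_{\mathcal E}F(x)=DF(x)|_{\mathcal E}$; $H^1_\gamma$ is the completion of $\mathcal{FC}^\infty$ under $\|F\|^2_{H^1_\gamma}=\mathbb E_\gamma\|F\|_{\mathcal Y}^2+\mathbb E_\gamma\|D_{\mathcal E}F\|^2_{\mathrm{HS}(\mathcal E,\mathcal Y)}$, with $D_{\mathcal E}$ extended by continuity. Derivative-informed subspaces. $H_{\mathcal X}=\mathbb E_\gamma[D_{\mathcal E}F^*D_{\mathcal E}F]$ on $\mathcal E$ and $H_{\mathcal Y}=\mathbb E_\gamma[D_{\mathcal E}F\,D_{\mathcal E}F^*]$ on $\mathcal Y$ (adjoints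 with respect to $\mathcal E,\mathcal Y$), with orthonormal eigenbases $H_{\mathcal X}v_i^{\mathrm{DIS}}=\mu_i^{\mathrm{DIS}}v_i^{\mathrm{DIS}}$ (in $\mathcal E$) and $H_{\mathcal Y}u_i^{\mathrm{DIS}}=\lambda_i^{\mathrm{DIS}}u_i^{\mathrm{DIS}}$ (in $\mathcal Y$), eigenvalues in decreasing order. Given i.i.d. samples $x_1,\dots,x_N\sim\gamma$, $\widehat H_{\mathcal X}=\frac1N\sum_kD_{\mathcal E}F(x_k)^*D_{\mathcal E}F(x_k)$ and $\widehat H_{\mathcal Y}=\frac1N\sum_kD_{\mathcal E}F(x_k)D_{\mathcal E}F(x_k)^*$, with orthonormal eigenbases $\widehat v_i^{\mathrm{DIS}}$ and $\widehat u_i^{\mathrm{DIS}}$ in decreasing order of eigenvalues. $Q_r^{\mathrm{DIS}},\widehat Q_r^{\mathrm{DIS}}$ are the $\mathcal E$-orthogonal projections onto the spans of the first $r$ vectors $v_i^{\mathrm{DIS}}$, $\widehat v_i^{\mathrm{DIS}}$; $P_r^{\mathrm{DIS}},\widehat P_r^{\mathrm{DIS}}$ are the $\mathcal Y$-orthogonal projections onto the spans of the first $r$ vectors $u_i^{\mathrm{DIS}},\widehat u_i^{\mathrm{DIS}}$. The empirical bounds are for almost every realization of the samples; a zero gap in a denominator makes that entry of the minimum $+\infty$. *)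

(* Defs.v *)
From HB Require Import structures.
From mathcomp Require Import all_boot all_order all_algebra.
From mathcomp Require Import all_classical all_reals all_analysis.
Set Implicit Arguments.
Unset Strict Implicit.
Unset Printing Implicit Defensive.
Import Order.TTheory GRing.Theory Num.Theory.
Import numFieldNormedType.Exports.
Local Open Scope classical_set_scope.
Local Open Scope ring_scope.

HB.mixin Record CompleteNormedModule_isHilbert (R : realType) V
    of CompleteNormedModule R V := {
  inner : V -> V -> R ;
  innerC : forall x y : V, inner x y = inner y x ;
  innerDl : forall x y z : V, inner (x + y) z = inner x z + inner y z ;
  innerZl : forall (a : R) (x y : V), inner (a *: x) y = a * inner x y ;
  inner_normE : forall x : V, inner x x = `|x| ^+ 2
}.

#[short(type="hilbertType")]
HB.structure Definition Hilbert (R : realType) :=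
  { V of CompleteNormedModule_isHilbert R V & CompleteNormedModule R V }.

(* The carrier H equipped with its Borel sigma-algebra. *)
Definition borel {R : realType} (H : hilbertType R) :=
  g_sigma_algebraType (@open H).

Section hilbert_space.
Context {R : realType}.
Implicit Types H K : hilbertType R.

Definition separable H := exists D : set H, countable D /\ dense D.

Definition lin_indep H n (e : 'I_n -> H) :=
  forall c : 'I_n -> R, \sum_(i < n) c i *: e i = 0 -> forall i, c i = 0.

Definition infinite_dim H := forall n, exists e : 'I_n -> H, lin_indep e.

Definition orthonormal H (e : nat -> H) :=
  forall i j, inner (e i) (e j) = (i == j)%:R.

Definition orthonormal_basis H (e : nat -> H) :=
  orthonormal e /\
  forall x : H, series (fun i => inner x (e i) *: e i) @ \oo --> x.

(* Some orthonormal basis of H; meaningful when H is separable and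
   infinite-dimensional, and 0 when there is no basis indexed by nat. *)
Definition onb H : nat -> H := xget (fun=> 0) (@orthonormal_basis H).

Definition bounded_op H K (A : H -> K) := linear A /\ continuous A.

(* The adjoint of a bounded operator; 0 if there is none. *)
Definition adjoint H K (A : H -> K) : K -> H :=
  xget (fun=> 0) [set B | forall x y, inner (A x) y = inner x (B y)].

(* On bounded operators, neither quantity depends on the basis. *)
Definition hs_normsq H K (A : H -> K) : \bar R :=
  (\sum_(i <oo) (`|A (onb H i)| ^+ 2)%:E)%E.

Definition hs_norm H K (A : H -> K) : \bar R := sqrte (hs_normsq A).

Definition hilbert_schmidt H K (A : H -> K) :=
  bounded_op A /\ (hs_normsq A < +oo)%E.

Definition self_adjoint H (A : H -> H) :=
  forall x y, inner (A x) y = inner x (A y).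

Definition positive_op H (A : H -> H) :=
  [/\ bounded_op A, self_adjoint A & forall x, 0 <= inner (A x) x].

(* For a positive operator A, |A| = A, so that trace class means finite
   trace. *)
Definition positive_trace_class H (A : H -> H) :=
  positive_op A /\ (\sum_(i <oo) (inner (A (onb H i)) (onb H i))%:E < +oo)%E.

Definition is_sqrt_op H (S C : H -> H) :=
  positive_op S /\ forall x, S (S x) = C x.

Definition rank_op H K (r : nat) (A : H -> K) :=
  exists2 e : 'I_r -> K, lin_indep e &
    range A = [set y | exists c : 'I_r -> R, y = \sum_(i < r) c i *: e i].

Definition projections H (r : nat) : set (H -> H) :=
  [set P | [/\ linear P, forall x, P (P x) = P x, self_adjoint P &
               rank_op r P]].

(* Orthogonal projection onto the span of the first r vectors of an
   orthonormal sequence v. *)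
Definition proj_span H (v : nat -> H) (r : nat) : H -> H :=
  fun x => \sum_(i < r) inner x (v i) *: v i.

(* Orthonormal eigenvectors v 0, v 1, ... of A with nonincreasing eigenvalues
   mu 0, mu 1, ..., complete up to ker A. Every orthonormal eigenbasis listed
   in decreasing order is of this form (the last clause then says A 0 = 0).
   When A >= 0 is compact with infinite rank and a nonzero kernel, no basis of
   the whole space can be listed along nat in decreasing order; v is then an
   eigenbasis of the orthogonal complement of the kernel. *)
Definition ordered_eigenbasis H (A : H -> H) (mu : nat -> R) (v : nat -> H) :=
  [/\ orthonormal v,
      forall i, A (v i) = mu i *: v i,
      nonincreasing_seq mu &
      forall x, (forall i, inner x (v i) = 0) -> A x = 0].

End hilbert_space.

Section gaussian.
Context {R : realType} (X : hilbertType R).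
Variable gamma : probability (borel X) R.

(* gamma = N(0, C): the law of <w, x> is N(0, <C w, w>) for every w. The
   degenerate case is separate since normal_prob 0 0 is not a Dirac mass. *)
Definition centered_gaussian (C : X -> X) :=
  positive_trace_class C /\
  forall (w : X) (A : set (measurableTypeR R)), measurable A ->
    gamma (inner w @^-1` A) =
      if inner (C w) w == 0 then \d_(0 : R) A
      else normal_prob 0 (Num.sqrt (inner (C w) w)) A.

(* Mean of a random operator T, in the weak sense. *)
Definition operator_mean (H : hilbertType R) (T : X -> H -> H) (M : H -> H) :=
  bounded_op M /\
  forall a b, ((inner (M a) b)%:E = \int[gamma]_x (inner (T x a) b)%:E)%E.

End gaussian.

(* E, embedded by iota, is the range of S = C^{1/2} (S injective), with
   <S x, S y>_E = <x, y>_X. *)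
Definition cameron_martin {R : realType} {X E : hilbertType R} (S : X -> X)
    (iota : E -> X) :=
  [/\ linear iota, injective iota, range iota = range S &
      forall (a b : E) (x y : X),
        iota a = S x -> iota b = S y -> inner a b = inner x y].

(* E := X with iota := S is a model of this space. *)
Lemma cameron_martin_model {R : realType} (X : hilbertType R) (S : X -> X) :
  linear S -> injective S -> cameron_martin S S.
Proof. by move=> Sl Si; split=> // a b x y /Si -> /Si ->. Qed.

Section sobolev.
Context {R : realType} {X E Y : hilbertType R}.

(* Iterated partial derivative along the list of coordinates s. *)
Definition partials n (s : seq 'I_n) (phi : 'rV[R]_n -> R) : 'rV[R]_n -> R :=
  foldr (fun i f => fun x => 'D_(delta_mx 0 i) f x) phi s.

(* C_b^oo(R^n). *)
Definition Cb_infty n (phi : 'rV[R]_n -> R) :=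
  forall s, (forall x, differentiable (partials s phi) x) /\
            exists B : R, forall x, `|partials s phi x| <= B.

Definition FC_infty (F : X -> Y) :=
  exists (n M : nat) (w : 'I_n -> X) (y : 'I_M -> Y)
         (phi : 'I_M -> 'rV[R]_n -> R),
    (forall i, Cb_infty (phi i)) /\
    forall x, F x = \sum_(i < M) phi i (\row_j inner (w j) x) *: y i.

Variables (gamma : probability (borel X) R) (iota : E -> X).

(* D_E F (x) = DF(x) restricted to E, for a differentiable F. *)
Definition cm_gradient (F : X -> Y) (x : X) : E -> Y :=
  fun e => 'd F x (iota e).

(* F belongs to H^1_gamma, with D_E F = DF. The completion of FC_infty is
   realised as the closure of { (F, D_E F) | F in FC_infty } in
   L^2(gamma; Y) x L^2(gamma; HS(E, Y)), the extension of D_E by continuity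
   being the second projection; F and DF are representatives of the classes.
   HS(E, Y) being separable, measurability of DF is that of DF(.) e for all
   e. *)
Definition H1_gamma (F : X -> Y) (DF : X -> E -> Y) :=
  [/\ measurable_fun [set: borel X] (F : borel X -> borel Y),
      forall e, measurable_fun [set: borel X]
                  ((fun x => DF x e) : borel X -> borel Y),
      forall x, hilbert_schmidt (DF x) &
      exists2 Fn : nat -> X -> Y, forall n, FC_infty (Fn n) &
        ((\int[gamma]_x (`|Fn n x - F x| ^+ 2)%:E
          + \int[gamma]_x hs_normsq (fun e => (cm_gradient (Fn n) x e - DF x e)%R))%E
            @[n --> \oo] --> 0%E)].

End sobolev.

Section derivative_informed.
Context {R : realType} {X E Y : hilbertType R}.
Variables (gamma : probability (borel X) R) (DF : X -> E -> Y).

(* E[ ||D_E F (I - Q)||_HS^2 ] and E[ ||(I - P) D_E F||_HS^2 ]. *)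
Definition input_error (Q : E -> E) : \bar R :=
  (\int[gamma]_x hs_normsq (fun e => DF x (e - Q e)%R))%E.

Definition output_error (P : Y -> Y) : \bar R :=
  (\int[gamma]_x hs_normsq (fun e => (DF x e - P (DF x e))%R))%E.

Definition input_gram (x : X) : E -> E := fun e => adjoint (DF x) (DF x e).

Definition output_gram (x : X) : Y -> Y := fun y => DF x (adjoint (DF x) y).

End derivative_informed.

Definition sample_mean {R : realType} {X H : hilbertType R} (T : X -> H -> H)
    (N : nat) (x : 'I_N -> X) : H -> H :=
  fun a => N%:R^-1 *: \sum_(k < N) T (x k) a.

(* Mutually independent random elements of X with common law gamma. *)
Definition iid_samples {R : realType} {X : hilbertType R}
    (gamma : probability (borel X) R) (d : measure_display)
    (Omega : measurableType d) (P : probability Omega R)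
    (N : nat) (xi : 'I_N -> Omega -> X) :=
  [/\ forall k, measurable_fun [set: Omega] (xi k : Omega -> borel X),
      forall k (A : set (borel X)), measurable A ->
        P (xi k @^-1` A) = gamma A &
      forall A : 'I_N -> set (borel X), (forall k, measurable (A k)) ->
        P (\bigcap_(k in [set: 'I_N]) (xi k @^-1` A k)) =
          (\prod_(k < N) P (xi k @^-1` A k))%E].

(* min { sqrt(2 r) ||D||_HS, 2 ||D||_HS^2 / gap }, the second entry being +oo
   when gap = 0. *)
Definition subspace_penalty {R : realType} {H : hilbertType R} (r : nat)
    (gap : R) (D : H -> H) : \bar R :=
  mine ((Num.sqrt (2 * r%:R))%:E * hs_norm D)%E
       (if gap == 0 then +oo%E else (2%:E * hs_normsq D * gap^-1%:E)%E).

(* Main.v *)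
Require Import Defs.
From mathcomp Require Import all_boot all_order all_algebra.
From mathcomp Require Import all_classical all_reals all_analysis.
From mathcomp Require Import measurable_realfun.
From mathcomp Require Import ring lra.
Import Order.TTheory GRing.Theory Num.Theory.
Import numFieldNormedType.Exports.
Local Open Scope classical_set_scope.
Local Open Scope ring_scope.

Set Implicit Arguments.
Unset Strict Implicit.
Unset Printing Implicit Defensive.

(** Write A for the random operator D_E F(x), T for A^* A or A A^*, H for its
    mean, and B = I - Q for a projection Q.  Both reconstruction errors are
    integrals of the trace of B T B; Tonelli exchanges the integral with the
    sum over a basis, and the error becomes tr (B H B).  On the output side
    this uses that A and its adjoint have the same Hilbert-Schmidt norm
    ([hs_dual]).

    Expanding the form of H in its eigenvectors v_k turns the trace into
    sum_k mu_k |B v_k|^2.  For Q the projection on orthonormal w_0 .. w_(r-1),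
    |B v_k|^2 = 1 - sum_l <v_k, w_l>^2, hence ([trace_residual])
      error(Q) = sum_(k >= r) mu_k + excess(w),
      excess(w) = sum_(k < r) mu_k - sum_(k < r) <H w_k, w_k>.
    This identity holds in the extended reals, so that an infinite trace needs
    no separate treatment.  The excess vanishes for w = v.  It is nonnegative by
    the Ky Fan principle, in the quantitative form ([ky_fan])
      (mu_(r-1) - mu_r) (r - tau) <= excess(w),
      tau = sum_(j, k < r) <w_k, v_j>^2.
    A rank r projection is of the form considered, by Gram-Schmidt
    ([projectionsE]), and optimality follows.

    For the empirical bounds let w be the eigenvectors of the sample mean H',
    D = H - H', and P_v, P_w the projections on the first r vectors.  As w
    maximises the trace of H' over orthonormal families of r vectors, by Ky Fan
    again, tr (H' (P_v - P_w)) <= 0, and excess(w) = tr (H (P_v - P_w)) is at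
    most tr (D (P_v - P_w)).  Since |P_v - P_w|_HS^2 = 2 (r - tau),
    Cauchy-Schwarz gives
      excess(w)^2 <= 2 (r - tau) |D|_HS^2      ([excess_sq_le]).
    Bounding tau below by 0 yields the first entry of the minimum; bounding
    r - tau by excess(w) / gap yields the second.  The argument applies to every
    sample at which the eigenbasis exists.

    Hilbert-Schmidt norms are computed in a chosen basis, so that bases of X, E
    and Y have to be constructed: Gram-Schmidt on a dense sequence for X and Y,
    and transport along the isometry of X onto E given by the square root of
    the covariance. *)

(** * Inner products and linear maps *)

Section inner_product.
Context {R : realType}.
Implicit Types H K : hilbertType R.

Lemma inner0l H (y : H) : inner 0 y = 0.
Proof. by rewrite -(scale0r (0 : H)) innerZl mul0r. Qed.

Lemma inner0r H (y : H) : inner y 0 = 0.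
Proof. by rewrite innerC inner0l. Qed.

Lemma innerNl H (x y : H) : inner (- x) y = - inner x y.
Proof. by rewrite -scaleN1r innerZl mulN1r. Qed.

Lemma innerBl H (x y z : H) : inner (x - y) z = inner x z - inner y z.
Proof. by rewrite innerDl innerNl. Qed.

Lemma innerDr H (x y z : H) : inner x (y + z) = inner x y + inner x z.
Proof. by rewrite innerC innerDl ![inner _ x]innerC. Qed.

Lemma innerBr H (x y z : H) : inner x (y - z) = inner x y - inner x z.
Proof. by rewrite innerC innerBl ![inner _ x]innerC. Qed.

Lemma innerZr H (a : R) (x y : H) : inner x (a *: y) = a * inner x y.
Proof. by rewrite innerC innerZl innerC. Qed.

Lemma inner_suml H I (s : seq I) (P : pred I) (f : I -> H) (y : H) :
  inner (\sum_(i <- s | P i) f i) y = \sum_(i <- s | P i) inner (f i) y.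
Proof.
apply: (big_morph (fun x => inner x y)) => [x z|]; first exact: innerDl.
exact: inner0l.
Qed.

Lemma inner_sumr H I (s : seq I) (P : pred I) (f : I -> H) (y : H) :
  inner y (\sum_(i <- s | P i) f i) = \sum_(i <- s | P i) inner y (f i).
Proof. by rewrite innerC inner_suml; apply: eq_bigr => i _; rewrite innerC. Qed.

Lemma inner_eq0 H (x : H) : inner x x = 0 -> x = 0.
Proof. by move/eqP; rewrite inner_normE sqrf_eq0 normr_eq0 => /eqP. Qed.

Lemma inner_inj H (x y : H) : (forall z, inner x z = inner y z) -> x = y.
Proof.
by move=> xy; apply/eqP; rewrite -subr_eq0; apply/eqP/inner_eq0;
  rewrite innerBl xy subrr.
Qed.

Lemma normsqB H (x y : H) :
  `|x - y| ^+ 2 = `|x| ^+ 2 - 2 * inner x y + `|y| ^+ 2.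
Proof. by rewrite -!inner_normE innerBl !innerBr (innerC y x); ring. Qed.

Lemma quadratic_ge0_discr (a b c : R) : 0 <= c ->
  (forall t, 0 <= a - 2 * t * b + t ^+ 2 * c) -> b ^+ 2 <= a * c.
Proof.
rewrite le_eqVlt => /predU1P[<-|c0] h.
  have [->|b0] := eqVneq b 0; first by rewrite expr0n mulr0.
  have := h ((a + 1) / (2 * b)).
  have -> : a - 2 * ((a + 1) / (2 * b)) * b + ((a + 1) / (2 * b)) ^+ 2 * 0 = -1.
    by field.
  by rewrite ler0N1.
have := h (b / c).
have -> : a - 2 * (b / c) * b + (b / c) ^+ 2 * c = (a * c - b ^+ 2) / c.
  by field; rewrite gt_eqF.
by rewrite pmulr_lge0 ?invr_gt0// subr_ge0.
Qed.

(** The discriminant of t |-> sum_i |f i - t g i|^2.  Stated for sums because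
    it serves both for vectors and for Hilbert-Schmidt inner products. *)
Lemma cauchy_schwarz_sum H I (s : seq I) (f g : I -> H) :
  (\sum_(i <- s) inner (f i) (g i)) ^+ 2 <=
  (\sum_(i <- s) `|f i| ^+ 2) * (\sum_(i <- s) `|g i| ^+ 2).
Proof.
apply: quadratic_ge0_discr => [|t].
  by apply: sumr_ge0 => i _; exact: sqr_ge0.
have -> : \sum_(i <- s) `|f i| ^+ 2 - 2 * t * (\sum_(i <- s) inner (f i) (g i))
    + t ^+ 2 * (\sum_(i <- s) `|g i| ^+ 2) = \sum_(i <- s) `|f i - t *: g i| ^+ 2.
  rewrite !mulr_sumr -sumrB -big_split; apply: eq_bigr => i _ /=.
  by rewrite normsqB innerZr -!inner_normE innerZl innerZr; ring.
by apply: sumr_ge0 => i _; exact: sqr_ge0.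
Qed.

Lemma cauchy_schwarz H (x y : H) : `|inner x y| <= `|x| * `|y|.
Proof.
have := cauchy_schwarz_sum [:: tt] (fun=> x) (fun=> y).
by rewrite !big_seq1 -exprMn -real_normK ?num_real// ler_pXn2r// nnegrE mulr_ge0.
Qed.

Lemma inner_continuous H (y : H) : continuous (fun x => inner x y).
Proof.
move=> x; apply/cvgrPdist_lt => e e0.
have y0 : 0 < `|y| + 1 by rewrite ltr_pwDr.
near=> z.
rewrite -innerBl (le_lt_trans (cauchy_schwarz _ _))//.
have : `|x - z| < e / (`|y| + 1).
  by near: z; apply: cvgr_dist_lt; rewrite ?divr_gt0.
rewrite ltr_pdivlMr//; apply: le_lt_trans.
by rewrite ler_wpM2l// lerDl.
Unshelve. all: by end_near. Qed.

Lemma inner_cvg H (f : nat -> H) (x y : H) :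
  f @ \oo --> x -> (fun n => inner (f n) y) @ \oo --> inner x y.
Proof. by move=> fx; exact: (cvg_comp _ _ fx (@inner_continuous H y x)). Qed.

Lemma lin0 H K (A : H -> K) : linear A -> A 0 = 0.
Proof. by move=> lA; have := lA (-1) 0 0; rewrite !scaleN1r !addNr. Qed.

Lemma linZ H K (A : H -> K) : linear A -> forall a x, A (a *: x) = a *: A x.
Proof. by move=> lA a x; rewrite -[a *: x]addr0 lA lin0// addr0. Qed.

Lemma linD H K (A : H -> K) : linear A -> {morph A : x y / x + y}.
Proof. by move=> lA x y; rewrite -[x]scale1r lA !scale1r. Qed.

Lemma linB H K (A : H -> K) : linear A -> {morph A : x y / x - y}.
Proof. by move=> lA x y; rewrite linD// -scaleN1r linZ// scaleN1r. Qed.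

Lemma lin_sum H K (A : H -> K) I (s : seq I) (P : pred I) (f : I -> H) :
  linear A -> A (\sum_(i <- s | P i) f i) = \sum_(i <- s | P i) A (f i).
Proof.
by move=> lA; apply: (big_morph A) => [x y|]; [exact: linD|exact: lin0].
Qed.

End inner_product.

(** * Finite orthonormal families *)

Section orthonormal_families.
Context {R : realType}.
Implicit Types H K : hilbertType R.

(** A finite family is an initial segment of a sequence, the format on which
    [proj_span] operates. *)
Definition orthonormal_upto H (n : nat) (e : nat -> H) :=
  forall i j, (i < n)%N -> (j < n)%N -> inner (e i) (e j) = (i == j)%:R.

Lemma orthonormalW H (e : nat -> H) n : Defs.orthonormal e -> orthonormal_upto n e.
Proof. by move=> oe i j _ _; exact: oe. Qed.

Lemma proj_span_linear H (e : nat -> H) n : linear (proj_span e n).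
Proof.
move=> a x y; rewrite /proj_span scaler_sumr -big_split; apply: eq_bigr => i _.
by rewrite innerDl innerZl scalerDl scalerA.
Qed.

Lemma inner_proj_span H (e : nat -> H) n x y :
  inner (proj_span e n x) y = \sum_(i < n) inner x (e i) * inner y (e i).
Proof.
by rewrite inner_suml; apply: eq_bigr => i _; rewrite innerZl (innerC y).
Qed.

Lemma proj_span_self_adjoint H (e : nat -> H) n : self_adjoint (proj_span e n).
Proof.
move=> x y; rewrite (innerC x) !inner_proj_span.
by apply: eq_bigr => i _; rewrite mulrC.
Qed.

Section fixed_family.
Variables (H : hilbertType R) (n : nat) (e : nat -> H).
Hypothesis oe : orthonormal_upto n e.

Lemma inner_comb_orthonormal (c : nat -> R) j : (j < n)%N ->
  inner (\sum_(i < n) c i *: e i) (e j) = c j.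
Proof.
move=> jn; rewrite inner_suml (bigD1 (Ordinal jn))//= innerZl oe// eqxx mulr1.
rewrite big1 ?addr0// => i ij; rewrite innerZl oe//.
by rewrite (negbTE (_ : i != j :> nat)) ?mulr0//; apply: contraNneq ij => ij;
  apply/eqP/val_inj.
Qed.

Lemma inner_proj_span_vec x j : (j < n)%N ->
  inner (proj_span e n x) (e j) = inner x (e j).
Proof. by move=> jn; rewrite (inner_comb_orthonormal (fun i => inner x (e i))). Qed.

Lemma proj_span_comb (c : nat -> R) :
  proj_span e n (\sum_(i < n) c i *: e i) = \sum_(i < n) c i *: e i.
Proof.
by rewrite /proj_span; apply: eq_bigr => i _; rewrite inner_comb_orthonormal.
Qed.

Lemma proj_spanK x : proj_span e n (proj_span e n x) = proj_span e n x.
Proof. exact: (proj_span_comb (fun i => inner x (e i))). Qed.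

Lemma proj_span_vec j : (j < n)%N -> proj_span e n (e j) = e j.
Proof.
move=> jn; have := proj_span_comb (fun i => (i == j)%:R).
rewrite (bigD1 (Ordinal jn))//= eqxx scale1r big1 ?addr0// => i ij.
by rewrite (negbTE (_ : i != j :> nat)) ?scale0r//; apply: contraNneq ij => ij;
  apply/eqP/val_inj.
Qed.

Lemma normsq_proj_span x :
  `|proj_span e n x| ^+ 2 = \sum_(i < n) inner x (e i) ^+ 2.
Proof.
rewrite -inner_normE proj_span_self_adjoint proj_spanK innerC inner_proj_span.
by apply: eq_bigr => i _; rewrite expr2.
Qed.

Lemma normsq_residual x : `|x - proj_span e n x| ^+ 2 =
  `|x| ^+ 2 - \sum_(i < n) inner x (e i) ^+ 2.
Proof.
rewrite normsqB normsq_proj_span innerC inner_proj_span.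
under [in X in 2 * X]eq_bigr do rewrite -expr2.
by ring.
Qed.

Lemma bessel x : \sum_(i < n) inner x (e i) ^+ 2 <= `|x| ^+ 2.
Proof. by rewrite -subr_ge0 -normsq_residual sqr_ge0. Qed.

(** Subtracting from x a vector y of the span does not change the residual, and
    a residual is never longer than the vector it comes from. *)
Lemma residual_le x y : proj_span e n y = y ->
  `|x - proj_span e n x| <= `|x - y|.
Proof.
move=> yE; have -> : x - proj_span e n x = (x - y) - proj_span e n (x - y).
  by rewrite (linB (@proj_span_linear _ _ _)) yE opprB addrA subrK.
rewrite -(@ler_pXn2r _ 2)// ?nnegrE// normsq_residual gerBl.
by apply: sumr_ge0 => i _; exact: sqr_ge0.
Qed.

Lemma orthonormal_lin_indep : lin_indep (fun i : 'I_n => e i).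
Proof.
move=> c c0 i; have := inner_comb_orthonormal (fun k => oapp c 0 (insub k)) (ltn_ord i).
rewrite (eq_bigr (fun k : 'I_n => c k *: e k)) => [|k _]; last by rewrite valK.
by rewrite c0 inner0l valK /= => <-.
Qed.

End fixed_family.
End orthonormal_families.

(** * Orthonormal series and Gram-Schmidt *)

Section completeness.
Context {R : realType}.
Implicit Types H K : hilbertType R.

Lemma eq_proj_span H (e f : nat -> H) n x :
  (forall i, (i < n)%N -> e i = f i) -> proj_span e n x = proj_span f n x.
Proof. by move=> ef; apply: eq_bigr => i _; rewrite ef. Qed.

Lemma normsq_comb_iota H (v : nat -> H) (c : nat -> R) m n :
  Defs.orthonormal v ->
  `|\sum_(m <= k < n) c k *: v k| ^+ 2 = \sum_(m <= k < n) c k ^+ 2.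
Proof.
move=> ov; rewrite -inner_normE inner_suml.
rewrite big_seq [RHS]big_seq; apply: eq_bigr => k kmn.
rewrite inner_sumr (bigD1_seq k)//= ?iota_uniq// innerZl innerZr ov eqxx mulr1.
rewrite big1 ?addr0 ?expr2// => j jk.
by rewrite innerZl innerZr ov eq_sym (negbTE jk) !mulr0.
Qed.

(** By Pythagoras the tails have the norms of the tails of the convergent series
    of the squared coefficients; completeness does the rest. *)
Lemma orthonormal_series_cvg H (v : nat -> H) (c : nat -> R) M :
  Defs.orthonormal v -> (forall n, \sum_(i < n) c i ^+ 2 <= M) ->
  cvgn (fun n => \sum_(i < n) c i *: v i).
Proof.
move=> ov cM.
have -> : (fun n => \sum_(i < n) c i *: v i) = series (fun i => c i *: v i).
  by apply/funext => n; rewrite /series /= big_mkord.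
apply: cauchy_cvg; apply/cauchy_seriesP => e e0.
have : cvgn (series (fun i => c i ^+ 2)).
  apply: nondecreasing_is_cvgn.
    apply/nondecreasing_seqP => n.
    by rewrite -subr_ge0 seriesSB sqr_ge0.
  by exists M => _ [n _ <-]; rewrite /series /= big_mkord.
move/cvg_cauchy/cauchy_seriesP/(_ (e ^+ 2)); rewrite exprn_gt0// => /(_ isT).
apply: filterS => -[m n] /=; rewrite ger0_norm; last first.
  by apply: sumr_ge0 => i _; exact: sqr_ge0.
by rewrite -(@normsq_comb_iota _ v)// ltr_pXn2r// nnegrE// ltW.
Qed.

(** The squared distance to the span decreases when the family grows. *)
Lemma proj_span_widen H (e : nat -> H) m n x : orthonormal_upto n e ->
  (m <= n)%N -> proj_span e m x = x -> proj_span e n x = x.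
Proof.
move=> oe mn mx.
have om : orthonormal_upto m e.
  by move=> i j im jm; apply: oe; exact: leq_trans mn.
apply/esym/eqP; rewrite -subr_eq0 -normr_eq0 -sqrf_eq0 eq_le sqr_ge0 andbT.
have <- : `|x - proj_span e m x| ^+ 2 = 0 by rewrite mx subrr normr0 expr0n.
rewrite !normsq_residual// lerD2l lerN2.
rewrite -!(big_mkord xpredT (fun i => inner x (e i) ^+ 2)).
rewrite [leRHS](big_cat_nat (leq0n m) mn)//= lerDl.
by apply: sumr_ge0 => i _; exact: sqr_ge0.
Qed.

(** A row killed by the matrix of coordinates of d in q is a linear relation
    between the vectors d. *)
Lemma span_dim H (n m : nat) (d : 'I_n -> H) (q : nat -> H) :
  lin_indep d -> (forall i, proj_span q m (d i) = d i) -> (n <= m)%N.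
Proof.
move=> li dq; pose A : 'M[R]_(n, m) := \matrix_(i, k) inner (d i) (q k).
suff : row_free A by rewrite -row_leq_rank => /leq_trans; apply; exact: rank_leq_col.
apply: inj_row_free => c cA; apply/rowP => i; rewrite mxE.
apply: (li (fun i => c 0 i)).
under eq_bigr do rewrite -dq /proj_span scaler_sumr.
rewrite exchange_big big1// => k _ /=.
under eq_bigr do rewrite scalerA.
rewrite -scaler_suml; have := congr1 (fun M : 'rV_m => M 0 k) cA.
rewrite !mxE => cAk; suff -> : \sum_(j < n) c 0 j * inner (d j) (q k) = 0.
  exact: scale0r.
by apply: etrans cAk; apply: eq_bigr => l _; rewrite mxE.
Qed.

End completeness.

Section gram_schmidt.
Context {R : realType} (H : hilbertType R).
Implicit Types (s : seq H) (x : H).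

Definition sproj s := proj_span (nth 0 s) (size s).

Lemma sproj_linear s : linear (sproj s).
Proof. exact: proj_span_linear. Qed.

(** Vectors already in the span are skipped, so that the length of the family
    is the dimension of the span. *)
Definition gs_step s x :=
  let z := x - sproj s x in if z == 0 then s else rcons s (`|z|^-1 *: z).

Fixpoint gs (d : nat -> H) n :=
  if n is m.+1 then gs_step (gs d m) (d m) else [::].

Lemma size_gs_step s x :
  (size s <= size (gs_step s x) <= (size s).+1)%N.
Proof. by rewrite /gs_step /=; case: ifP => _; rewrite ?size_rcons leqnn leqnSn. Qed.

Lemma nth_gs_step s x i : (i < size s)%N -> nth 0 (gs_step s x) i = nth 0 s i.
Proof. by rewrite /gs_step /=; case: ifP => _ // si; rewrite nth_rcons si. Qed.

Lemma gs_step_orthonormal s x : orthonormal_upto (size s) (nth 0 s) ->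
  orthonormal_upto (size (gs_step s x)) (nth 0 (gs_step s x)).
Proof.
move=> os; rewrite /gs_step /=; case: ifPn => // z0.
set z := x - _ in z0 *.
have zs i : (i < size s)%N -> inner z (nth 0 s i) = 0.
  by move=> si; rewrite innerBl inner_proj_span_vec// subrr.
have nz : `|z| != 0 by rewrite normr_eq0.
rewrite size_rcons => i j; rewrite !ltnS !nth_rcons.
rewrite [(i <= _)%N]leq_eqVlt [(j <= _)%N]leq_eqVlt.
move=> /predU1P[->|si] /predU1P[->|sj].
- by rewrite !ltnn !eqxx innerZl innerZr inner_normE expr2 mulKf// mulVf.
- by rewrite ltnn eqxx sj innerZl zs// mulr0 gtn_eqF.
- by rewrite si ltnn eqxx innerZr innerC zs// mulr0 ltn_eqF.
- by rewrite si sj os.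
Qed.

Lemma sproj_gs_step s x y : orthonormal_upto (size s) (nth 0 s) ->
  sproj s y = y -> sproj (gs_step s x) y = y.
Proof.
move=> os sy; have /andP[sz _] := size_gs_step s x.
rewrite /sproj; apply: (proj_span_widen (gs_step_orthonormal os) sz).
rewrite -[RHS]sy; apply: eq_proj_span => i; exact: nth_gs_step.
Qed.

(** x is the sum of its projection on the old span and a multiple of the new
    vector. *)
Lemma sproj_gs_step_new s x : orthonormal_upto (size s) (nth 0 s) ->
  sproj (gs_step s x) x = x.
Proof.
move=> os; have os' := gs_step_orthonormal (x := x) os.
have h : sproj (gs_step s x) (sproj s x) = sproj s x.
  by apply: sproj_gs_step => //; exact: proj_spanK.
suff hz : sproj (gs_step s x) (x - sproj s x) = x - sproj s x.
  by rewrite -{2}(subrK (sproj s x) x) (linD (@sproj_linear _)) hz h subrK.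
move: os'; rewrite /sproj /gs_step /=; case: ifPn => [/eqP -> _|].
  by rewrite (lin0 (@proj_span_linear _ _ _ _)).
rewrite size_rcons /sproj; set z := x - _ => z0.
set q := nth 0 _ => oq.
have -> : z = `|z| *: q (size s).
  by rewrite /q nth_rcons ltnn eqxx scalerA divff ?normr_eq0// scale1r.
by rewrite (linZ (@proj_span_linear _ _ _ _)) proj_span_vec.
Qed.

Lemma gs_orthonormal d n : orthonormal_upto (size (gs d n)) (nth 0 (gs d n)).
Proof. by elim: n => [|n IH] //=; exact: gs_step_orthonormal. Qed.

Lemma size_gs d n : (size (gs d n) <= n)%N.
Proof.
elim: n => [|n IH] //=; have /andP[_ /leq_trans] := size_gs_step (gs d n) (d n).
exact.
Qed.

Lemma gs_mono d m n : (m <= n)%N -> (size (gs d m) <= size (gs d n))%N.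
Proof.
move=> /subnK <-; elim: (n - m)%N => [|k IH] //; rewrite addSn /=.
by apply: (leq_trans IH); have /andP[] := size_gs_step (gs d (k + m)) (d (k + m)%N).
Qed.

Lemma nth_gs d m n i : (m <= n)%N -> (i < size (gs d m))%N ->
  nth 0 (gs d n) i = nth 0 (gs d m) i.
Proof.
move=> /subnK <- im; elim: (n - m)%N => [|k IH] //; rewrite addSn /=.
by rewrite nth_gs_step ?IH//; apply: (leq_trans im); rewrite gs_mono// leq_addl.
Qed.

Lemma sproj_gs d k n : (k < n)%N -> sproj (gs d n) (d k) = d k.
Proof.
move=> /subnK <-; elim: (n - k.+1)%N => [|m IH]; rewrite ?addSn /=.
  by apply: sproj_gs_step_new; exact: gs_orthonormal.
by apply: sproj_gs_step => //; exact: gs_orthonormal.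
Qed.

Lemma gs_invariant (V : H -> Prop) d n :
  (forall a x y, V x -> V y -> V (a *: x + y)) -> V 0 ->
  (forall k, (k < n)%N -> V (d k)) ->
  forall i, V (nth 0 (gs d n) i).
Proof.
move=> Vl V0; elim: n => [|n IH] dV i /=; first by rewrite nth_nil.
have {}IH := IH (fun k kn => dV k (ltnW kn)).
rewrite /gs_step /=; case: ifPn => // _; rewrite nth_rcons.
case: ifP => // _; case: ifP => // _.
rewrite -[_ *: _]addr0; apply: (Vl) => //; rewrite addrC -scaleN1r.
apply: (Vl); last exact: dV.
rewrite /sproj /proj_span; apply: big_ind => // [x y Vx Vy|k _].
  by rewrite -[x]scale1r; exact: (Vl).
by rewrite -[_ *: _]addr0; apply: (Vl).
Qed.

End gram_schmidt.

(** * Existence of orthonormal bases *)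

Section orthonormal_bases.
Context {R : realType}.
Implicit Types H K : hilbertType R.

Lemma orthonormal_basisP H (e : nat -> H) : orthonormal_basis e <->
  Defs.orthonormal e /\ forall x, (fun n => proj_span e n x) @ \oo --> x.
Proof.
suff h x : (fun n => proj_span e n x) = series (fun i => inner x (e i) *: e i).
  by split=> -[oe ce]; split=> // x; move: (ce x); rewrite h.
by apply/funext => n; rewrite /series /= big_mkord.
Qed.

Lemma separable_denseseq H : separable H ->
  exists d : nat -> H, forall x (eps : R), 0 < eps -> exists k, `|x - d k| < eps.
Proof.
case=> D [/(@pcard_surjP _ _ D setT)[d sd] dD]; exists d => x eps e0.
have [|y [xy Dy]] := dD (ball x eps) _ (ball_open _ _).
  by exists x; exact: ballxx.
by have [k _ dk] := sd _ Dy; exists k; rewrite dk; move: xy; rewrite -ball_normE.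
Qed.

(** If the length of the families stabilises, their common span is closed and
    contains a dense sequence, hence is the whole space, which would be finite
    dimensional. *)
Lemma sizes_gs_unbounded H (d : nat -> H) : infinite_dim H ->
  (forall x (eps : R), 0 < eps -> exists k, `|x - d k| < eps) ->
  forall i, exists n, (i < size (gs d n))%N.
Proof.
move=> iH dd i; apply/not_existsP => bnd.
have {}bnd n : (size (gs d n) <= i)%N by rewrite leqNgt; apply/negP.
pose Q k := `[< exists n, size (gs d n) = k >].
have Qex : exists k, Q k by exists (size (gs d 0)); apply/asboolP; exists 0%N.
have Qbnd k : Q k -> (k <= i)%N by move=> /asboolP[n <-].
case: (ex_maxnP Qex Qbnd) => m /asboolP[n0 n0m] mmax.
have span x : proj_span (nth 0 (gs d n0)) m x = x.
  have om : orthonormal_upto m (nth 0 (gs d n0)).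
    by rewrite -n0m; exact: gs_orthonormal.
  apply/esym/eqP; rewrite -subr_eq0 -normr_eq0; apply/eqP/le_anti.
  rewrite normr_ge0 andbT; apply/ler_addgt0Pl => eps e0; rewrite addr0.
  have [k /ltW] := dd x _ e0; apply: le_trans; apply: residual_le => //.
  have [n0n kn] : (n0 <= maxn n0 k.+1 /\ k < maxn n0 k.+1)%N.
    by rewrite leq_maxl leq_maxr.
  have sn : size (gs d (maxn n0 k.+1)) = m.
    apply/eqP; rewrite eqn_leq -{2}n0m gs_mono// andbT.
    by apply: mmax; apply/asboolP; eexists.
  rewrite -[RHS](sproj_gs d kn) /sproj sn; apply: eq_proj_span => j jm.
  by rewrite (nth_gs n0n)// n0m.
have [e le] := iH m.+1.
by have := span_dim le (fun j => span (e j)); rewrite ltnn.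
Qed.

(** The Gram-Schmidt families of a dense sequence extend one another; their
    union spans the sequence, and projections are best approximations. *)
Lemma exists_orthonormal_basis H : infinite_dim H -> separable H ->
  exists e : nat -> H, orthonormal_basis e.
Proof.
move=> iH /separable_denseseq[d dd].
have /choice[n nP] := sizes_gs_unbounded iH dd.
pose e i := nth 0 (gs d (n i)) i.
have eE m i : (i < size (gs d m))%N -> e i = nth 0 (gs d m) i.
  move=> im; rewrite /e; have [mn|/ltnW nm] := leqP m (n i).
    exact: nth_gs.
  by apply/esym/nth_gs.
have oe : Defs.orthonormal e.
  move=> i j; pose m := maxn (n i) (n j).
  (* Both vectors occur in the family of the later stage. *)
  have im : (i < size (gs d m))%N.
    by apply: (leq_trans (nP i)); rewrite gs_mono// leq_maxl.
  have jm : (j < size (gs d m))%N.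
    by apply: (leq_trans (nP j)); rewrite gs_mono// leq_maxr.
  by rewrite (eE m)// (eE m j)//; exact: gs_orthonormal.
exists e; apply/orthonormal_basisP; split=> // x.
apply/cvgrPdist_lt => eps e0; have [k xk] := dd x _ e0.
near=> N; apply: le_lt_trans xk.
apply: residual_le; first exact: orthonormalW.
apply: (@proj_span_widen _ _ _ (size (gs d k.+1))); first exact: orthonormalW.
  by near: N; exact: nbhs_infty_ge.
rewrite -[RHS](@sproj_gs _ _ d k k.+1)//; apply: eq_proj_span => i; exact: eE.
Unshelve. all: by end_near. Qed.

Lemma onbP H : (exists e : nat -> H, orthonormal_basis e) ->
  orthonormal_basis (onb H).
Proof. exact: xgetPex. Qed.

(** By [normsq_residual] the distances to the spans are determined by inner
    products, which J preserves. *)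
Lemma orthonormal_basis_transfer H K (J : H -> K) (e : nat -> H) :
  (forall x y, inner (J x) (J y) = inner x y) -> (forall a, exists x, J x = a) ->
  orthonormal_basis e -> orthonormal_basis (J \o e).
Proof.
move=> Ji Js /orthonormal_basisP[oe ce]; apply/orthonormal_basisP.
have oJ : Defs.orthonormal (J \o e) by move=> i j; rewrite Ji.
split=> // a; have [x <-] := Js a.
apply/cvgrPdist_lt => eps e0; near=> n.
have -> : `|J x - proj_span (J \o e) n (J x)| = `|x - proj_span e n x|.
  apply/(@pexpIrn _ 2) => //; rewrite ?nnegrE// !normsq_residual; last 2 first.
  - exact: orthonormalW.
  - exact: orthonormalW.
  by rewrite -!inner_normE Ji; congr (_ - _); apply: eq_bigr => i _; rewrite Ji.
by near: n; apply: cvgr_dist_lt.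
Unshelve. all: by end_near. Qed.

(** The map sending x to the point of E above S x is an isometry of X onto E. *)
Lemma cameron_martin_basis (X E : hilbertType R) (S : X -> X) (iota : E -> X) :
  cameron_martin S iota -> (exists e : nat -> X, orthonormal_basis e) ->
  exists e : nat -> E, orthonormal_basis e.
Proof.
move=> [_ iinj irange iinner] [e be].
have /choice[J JS] x : exists a, iota a = S x.
  by have : range S (S x) by []; rewrite -irange => -[a _ <-]; exists a.
exists (J \o e); apply: orthonormal_basis_transfer be => [x y|a].
  exact: iinner (JS x) (JS y).
have : range iota (iota a) by []; rewrite irange => -[x _ Sx].
by exists x; apply: iinj; rewrite JS.
Qed.

Section parseval.
Variables (H : hilbertType R) (e : nat -> H).
Hypothesis be : orthonormal_basis e.

Lemma parseval x y :
  (fun n => \sum_(i < n) inner x (e i) * inner y (e i)) @ \oo --> inner x y.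
Proof.
have [_ ce] := (orthonormal_basisP e).1 be.
have := inner_cvg (y := y) (ce x); apply: cvg_trans.
by apply: near_eq_cvg; apply: nearW => n; rewrite inner_proj_span.
Qed.

Lemma parseval_normsq x :
  (fun n => \sum_(i < n) inner x (e i) ^+ 2) @ \oo --> `|x| ^+ 2.
Proof. by rewrite -inner_normE; exact: parseval. Qed.

End parseval.
End orthonormal_bases.

(** * Finite rank projections *)

Section projections.
Context {R : realType} (H : hilbertType R).

Lemma proj_span_projections (v : nat -> H) r :
  orthonormal_upto r v -> projections r (proj_span v r).
Proof.
move=> ov; split.
- exact: proj_span_linear.
- exact: proj_spanK.
- exact: proj_span_self_adjoint.
exists (fun i : 'I_r => v i); first exact: orthonormal_lin_indep.
apply/seteqP; split=> [_ [x _ <-]|_ [c ->]] /=.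
  by exists (fun i => inner x (v i)).
exists (\sum_(i < r) c i *: v i) => //.
rewrite (lin_sum _ _ _ (@proj_span_linear _ _ _ _)).
by apply: eq_bigr => i _; rewrite (linZ (@proj_span_linear _ _ _ _)) proj_span_vec.
Qed.

(** Orthonormalising a basis of the range keeps it in the range, which Q fixes;
    self-adjointness then gives the coordinates of Q x. *)
Lemma projectionsE (Q : H -> H) r : projections r Q ->
  exists2 q, orthonormal_upto r q & Q = proj_span q r.
Proof.
move=> [lQ QK sQ [d li rQ]].
pose d' k := oapp d 0 (insub k : option 'I_r).
have d'E (i : 'I_r) : d' i = d i by rewrite /d' valK.
pose q := nth 0 (gs d' r).
have span i : proj_span q (size (gs d' r)) (d i) = d i.
  by rewrite -d'E; exact: sproj_gs.
have sr : size (gs d' r) = r.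
  by apply/eqP; rewrite eqn_leq size_gs; exact: span_dim li span.
rewrite sr in span.
have Qd i : Q (d i) = d i.
  have : range Q (d i).
    rewrite rQ; exists (fun j => (j == i)%:R).
    rewrite (bigD1 i)//= eqxx scale1r big1 ?addr0// => j /negbTE ->.
    by rewrite scale0r.
  by case=> x _ <-.
have Qq i : Q (q i) = q i.
  apply: (@gs_invariant _ _ (fun y => Q y = y)) => [a x y Qx Qy||k kr].
  - by rewrite lQ Qx Qy.
  - exact: lin0.
  - by rewrite -[k]/(nat_of_ord (Ordinal kr)) d'E.
have oq : orthonormal_upto r q.
  by have := @gs_orthonormal _ _ d' r; rewrite sr.
exists q => //; apply/funext => x.
have -> : Q x = proj_span q r (Q x).
  have : range Q (Q x) by [].
  rewrite rQ => -[c ->]; rewrite (lin_sum _ _ _ (@proj_span_linear _ _ _ _)).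
  by apply: eq_bigr => i _; rewrite (linZ (@proj_span_linear _ _ _ _)) span.
by apply: eq_bigr => i _; rewrite sQ Qq.
Qed.

End projections.

(** * The trace formula and the Ky Fan principle *)

Lemma cvg_sum {R : realType} I (s : seq I) (P : pred I) (f : I -> nat -> R)
    (l : I -> R) : (forall i, P i -> f i @ \oo --> l i) ->
  (fun n => \sum_(i <- s | P i) f i n) @ \oo --> \sum_(i <- s | P i) l i.
Proof.
move=> fl; elim: s => [|i s IH].
  by under eq_fun do rewrite big_nil; rewrite big_nil; exact: cvg_cst.
under eq_fun do rewrite big_cons; rewrite big_cons.
by case: ifP => // Pi; apply: cvgD IH; exact: fl.
Qed.

Section spectral.
Context {R : realType} (H : hilbertType R).
Implicit Types (A : H -> H) (mu : nat -> R) (v w e : nat -> H).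

Lemma eigenvalue_ge0 A mu v i : positive_op A -> ordered_eigenbasis A mu v ->
  0 <= mu i.
Proof.
move=> [_ _ A0] [ov Av _ _]; have := A0 (v i).
by rewrite Av innerZl ov eqxx mulr1.
Qed.

(** The series of the coordinates of x converges, to p say; A vanishes on x - p,
    which is orthogonal to every eigenvector, and is continuous. *)
Lemma eigenbasis_form A mu v x : positive_op A -> ordered_eigenbasis A mu v ->
  (fun n => \sum_(i < n) mu i * inner x (v i) ^+ 2) @ \oo --> inner (A x) x.
Proof.
move=> [[lA cA] _ _] [ov Av _ kerA].
have /cvg_ex[p xp] : cvgn (fun n => proj_span v n x).
  apply: (orthonormal_series_cvg (c := fun i => inner x (v i)) ov) => n.
  apply: bessel; exact: orthonormalW.
have Axp : A x = A p.
  apply/eqP; rewrite -subr_eq0 -linB//; apply/eqP/kerA => i.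
  rewrite innerBl; apply/eqP; rewrite subr_eq0; apply/eqP.
  apply/esym; apply: cvg_unique (inner_cvg (y := v i) xp) _ => //.
  apply: cvg_near_cst; exists i.+1 => // n /= ni.
  by rewrite inner_proj_span_vec//; exact: orthonormalW.
have Ap : (fun n => A (proj_span v n x)) @ \oo --> A p.
  exact: cvg_comp xp (cA p).
rewrite Axp; have := inner_cvg (y := x) Ap; apply: cvg_trans.
apply: near_eq_cvg; apply: nearW => n.
rewrite (lin_sum _ _ _ lA) inner_suml; apply: eq_bigr => i _.
by rewrite linZ// Av !innerZl (innerC (v i)); ring.
Qed.

(** Total weight at most r, each weight at most 1: the weight missing below r
    costs at least mu (r - 1) per unit, and moving it above r recovers at most
    mu r per unit. *)
Lemma weighted_sum_le (mu t : nat -> R) r n : nonincreasing_seq mu ->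
  (forall j, 0 <= mu j) -> (forall j, 0 <= t j <= 1) ->
  \sum_(j < n) t j <= r%:R -> (r <= n)%N ->
  \sum_(j < n) mu j * t j <=
  \sum_(j < r) mu j - (mu r.-1 - mu r) * (r%:R - \sum_(j < r) t j).
Proof.
move=> mu_dec mu0 t01 tr rn; move: tr.
have split (f : nat -> R) : \sum_(j < n) f j =
    \sum_(0 <= j < r) f j + \sum_(r <= j < n) f j.
  by rewrite -(big_mkord xpredT) (big_cat_nat (leq0n r) rn).
rewrite (split t) (split (fun j => mu j * t j)).
rewrite -(big_mkord xpredT mu) -(big_mkord xpredT t) => tr.
have h1 : mu r.-1 * (r%:R - \sum_(0 <= j < r) t j) <=
    \sum_(0 <= j < r) mu j - \sum_(0 <= j < r) mu j * t j.
  rewrite -sumrB (_ : r%:R = \sum_(0 <= j < r) 1); last first.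
    by rewrite sumr_const_nat subn0.
  rewrite -sumrB mulr_sumr; apply: ler_sum_nat => j /andP[_ jr].
  have -> : mu j - mu j * t j = mu j * (1 - t j) by ring.
  have /andP[_ tj] := t01 j.
  by apply: ler_wpM2r; [rewrite subr_ge0|apply: mu_dec; case: (r) jr].
have h2 : \sum_(r <= j < n) mu j * t j <= mu r * \sum_(r <= j < n) t j.
  rewrite mulr_sumr; apply: ler_sum_nat => j /andP[rj _].
  by apply: ler_wpM2r; [case/andP: (t01 j)|exact: mu_dec].
have h3 : mu r * \sum_(r <= j < n) t j <= mu r * (r%:R - \sum_(0 <= j < r) t j).
  by apply: ler_wpM2l => //; lra.
rewrite mulrBl; move: h1 (le_trans h2 h3).
move: (mu r.-1 * _) (mu r * _) => a b; lra.
Qed.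

(** The trace of the product of the projections on the two spans. *)
Definition overlap v w r := \sum_(j < r) \sum_(k < r) inner (w k) (v j) ^+ 2.

Definition excess A mu w r :=
  \sum_(k < r) mu k - \sum_(k < r) inner (A (w k)) (w k).

Lemma normsq_orthonormal_upto w r k : orthonormal_upto r w -> (k < r)%N ->
  `|w k| ^+ 2 = 1.
Proof. by move=> ow kr; rewrite -inner_normE ow// eqxx. Qed.

Lemma overlap_le v w r : orthonormal_upto r w -> orthonormal_upto r v ->
  overlap v w r <= r%:R.
Proof.
move=> ow ov; rewrite -[r%:R]mulr1n -[in leRHS](card_ord r) -sumr_const.
apply: ler_sum => j _; rewrite -(normsq_orthonormal_upto ov (ltn_ord j)).
by under eq_bigr do rewrite innerC; exact: bessel.
Qed.

(** [weighted_sum_le] for the weights sum_k <w k, v j>^2, which are at most 1 and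
    of total at most r by Bessel's inequality for w and for v. *)
Lemma ky_fan A mu v w r : positive_op A -> ordered_eigenbasis A mu v ->
  orthonormal_upto r w ->
  (mu r.-1 - mu r) * (r%:R - overlap v w r) <= excess A mu w r.
Proof.
move=> pA eA ow; have [ov _ mu_dec _] := eA.
rewrite /excess lerBrDr addrC -lerBrDr.
pose t j := \sum_(k < r) inner (w k) (v j) ^+ 2.
have Aw : (fun n => \sum_(j < n) mu j * t j) @ \oo -->
    \sum_(k < r) inner (A (w k)) (w k).
  have : (fun n => \sum_(k < r) \sum_(j < n) mu j * inner (w k) (v j) ^+ 2)
      @ \oo --> \sum_(k < r) inner (A (w k)) (w k).
    by apply: cvg_sum => k _; exact: eigenbasis_form.
  apply: cvg_trans; apply: near_eq_cvg; apply: nearW => n /=.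
  rewrite exchange_big; apply: eq_bigr => j _.
  by rewrite mulr_sumr.
apply: cvgr_to_le Aw _; exists r => // n /= rn.
apply: weighted_sum_le => // [j|j|].
- exact: eigenvalue_ge0 pA eA.
- rewrite sumr_ge0 => [|k _]; last exact: sqr_ge0.
  have := bessel ow (v j).
  rewrite (normsq_orthonormal_upto (orthonormalW (n := j.+1) ov))//.
  by under eq_bigr do rewrite innerC.
- rewrite exchange_big -[r%:R]mulr1n -[in leRHS](card_ord r) -sumr_const.
  apply: ler_sum => k _; rewrite -(normsq_orthonormal_upto ow (ltn_ord k)).
  by apply: bessel; exact: orthonormalW.
Qed.

Lemma excess_ge0 A mu v w r : positive_op A -> ordered_eigenbasis A mu v ->
  orthonormal_upto r w -> 0 <= excess A mu w r.
Proof.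
move=> pA eA ow; apply: le_trans (ky_fan pA eA ow); have [ov _ mu_dec _] := eA.
rewrite mulr_ge0// subr_ge0; first by apply: mu_dec; exact: leq_pred.
by apply: overlap_le => //; exact: orthonormalW.
Qed.

Lemma excess_eigenbasis A mu v r : ordered_eigenbasis A mu v ->
  excess A mu v r = 0.
Proof.
move=> [ov Av _ _]; rewrite /excess -sumrB big1// => k _.
by rewrite Av innerZl ov eqxx mulr1 subrr.
Qed.

Lemma eseries_cvg (f : nat -> R) l :
  (fun n => \sum_(i < n) f i) @ \oo --> l -> (\sum_(i <oo) (f i)%:E = l%:E)%E.
Proof.
move=> fl; apply/cvg_lim => //.
have -> : (fun n => \sum_(0 <= i < n) (f i)%:E)%E
    = (fun n => (\sum_(i < n) f i)%:E).
  by apply/funext => n; rewrite big_mkord sumEFin.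
by apply: cvg_EFin => //; exact: nearW.
Qed.

(** With B = I - Q, the left-hand side is sum_i sum_k mu k <B e i, v k>^2; summing
    over i first gives sum_k mu k |B v k|^2, and |B v k|^2 = 1 - t k where the
    sum of the mu k * t k is the finite trace of A over w. *)
Lemma trace_residual A mu v w e r : positive_op A -> ordered_eigenbasis A mu v ->
  orthonormal_basis e -> orthonormal_upto r w ->
  (\sum_(i <oo) (inner (A (e i - proj_span w r (e i)))
                       (e i - proj_span w r (e i)))%:E =
   \sum_(r <= i <oo) (mu i)%:E + (excess A mu w r)%:E)%E.
Proof.
move=> pA eA be ow; have [ov _ _ _] := eA.
have mu0 i := eigenvalue_ge0 i pA eA.
pose B x := x - proj_span w r x.
have sB : self_adjoint B.
  by move=> x y; rewrite innerBl innerBr proj_span_self_adjoint.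
pose t k := \sum_(l < r) inner (w l) (v k) ^+ 2.
have t1 k : `|B (v k)| ^+ 2 = 1 - t k.
  rewrite normsq_residual// (normsq_orthonormal_upto (orthonormalW (n := k.+1) ov))//.
  by congr (_ - _); apply: eq_bigr => l _; rewrite innerC.
have t0 k : 0 <= t k by apply: sumr_ge0 => l _; exact: sqr_ge0.
have -> : (\sum_(i <oo) (inner (A (B (e i))) (B (e i)))%:E
    = \sum_(k <oo) (mu k * (1 - t k))%:E)%E.
  transitivity (\sum_(i <oo) \sum_(k <oo) (mu k * inner (B (e i)) (v k) ^+ 2)%:E)%E.
    apply: eq_eseriesr => i _; apply/esym/eseries_cvg; exact: eigenbasis_form.
  rewrite nneseries_interchange => [|i k]; last first.
    by rewrite lee_fin mulr_ge0 ?sqr_ge0.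
  apply: eq_eseriesr => k _; rewrite -t1; apply: eseries_cvg.
  under eq_fun do rewrite -mulr_sumr.
  apply: cvgM; first exact: cvg_cst.
  have := parseval_normsq be (x := B (v k)); apply: cvg_trans.
  apply: near_eq_cvg; apply: nearW => n /=.
  by apply: eq_bigr => i _; rewrite sB innerC.
have tA : (\sum_(k <oo) (mu k * t k)%:E
    = (\sum_(l < r) inner (A (w l)) (w l))%:E)%E.
  apply: eseries_cvg.
  have : (fun n => \sum_(k < r) \sum_(j < n) mu j * inner (w k) (v j) ^+ 2)
      @ \oo --> \sum_(k < r) inner (A (w k)) (w k).
    by apply: cvg_sum => k _; exact: eigenbasis_form.
  apply: cvg_trans; apply: near_eq_cvg; apply: nearW => n /=.
  rewrite exchange_big; apply: eq_bigr => j _.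
  by rewrite mulr_sumr.
have t1' k : 0 <= 1 - t k by rewrite -t1 sqr_ge0.
(* The trace of A may be infinite; only the finite sum of the mu k * t k is
   subtracted. *)
have : (\sum_(k <oo) (mu k * (1 - t k))%:E + \sum_(k <oo) (mu k * t k)%:E
    = (\sum_(k < r) mu k)%:E + \sum_(r <= k <oo) (mu k)%:E)%E.
  rewrite -nneseriesD => [|k _ _|k _ _]; last 2 first.
  - by rewrite lee_fin mulr_ge0.
  - by rewrite lee_fin mulr_ge0.
  rewrite -sumEFin -(big_mkord xpredT (fun k => (mu k)%:E)).
  have := @nneseries_split R (fun k => (mu k)%:E) 0 r; rewrite add0n => <-.
    apply: eq_eseriesr => k _; rewrite -EFinD; congr (_%:E); ring.
  by move=> k _; rewrite lee_fin.
rewrite tA => /(congr1 (fun x => x - (\sum_(l < r) inner (A (w l)) (w l))%:E)%E).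
by rewrite addeK// => ->; rewrite addeAC addeC EFinB.
Qed.

End spectral.

(** * Excess of the eigenspaces of a perturbed operator *)

Section empirical_penalty.
Context {R : realType} (H : hilbertType R).
Variables (A B : H -> H) (mu nu : nat -> R) (v w : nat -> H) (e : nat -> H).
Variable r : nat.
Hypotheses (pA : positive_op A) (pB : positive_op B).
Hypotheses (eA : ordered_eigenbasis A mu v) (eB : ordered_eigenbasis B nu w).

Let D : H -> H := A \- B.

Let ov : orthonormal_upto r v.
Proof. by case: eA => ov _ _ _; exact: orthonormalW. Qed.

Let ow : orthonormal_upto r w.
Proof. by case: eB => ow _ _ _; exact: orthonormalW. Qed.

Let sD : self_adjoint D.
Proof.
by case: pA pB => _ sA _ [_ sB _] x y; rewrite innerBl innerBr sA sB.
Qed.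

(** The difference of the two sides is the excess of v for B. *)
Lemma excess_le_trace_diff : excess A mu w r <=
  \sum_(k < r) inner (D (v k)) (v k) - \sum_(k < r) inner (D (w k)) (w k).
Proof.
have := excess_ge0 pB eB ov; have := excess_eigenbasis r eA.
have := excess_eigenbasis r eB; rewrite /excess => hB hA h.
rewrite [X in _ <= X - _](eq_bigr (fun k : 'I_r =>
  inner (A (v k)) (v k) - inner (B (v k)) (v k))); last first.
  by move=> k _; rewrite innerBl.
rewrite [X in _ <= _ - X](eq_bigr (fun k : 'I_r =>
  inner (A (w k)) (w k) - inner (B (w k)) (w k))); last first.
  by move=> k _; rewrite innerBl.
rewrite !sumrB; lra.
Qed.

Hypothesis be : orthonormal_basis e.

(** The squared Hilbert-Schmidt norm of a difference of two rank r projections,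
    expanded by Parseval: r + r minus twice the overlap. *)
Lemma proj_diff_normsq_cvg :
  (fun n => \sum_(i < n) `|proj_span v r (e i) - proj_span w r (e i)| ^+ 2)
    @ \oo --> 2 * (r%:R - overlap v w r).
Proof.
have vcvg u : orthonormal_upto r u ->
    (fun n => \sum_(k < r) \sum_(i < n) inner (u k) (e i) ^+ 2) @ \oo --> (r%:R : R).
  move=> ou; have -> : (r%:R : R) = \sum_(k < r) `|u k| ^+ 2.
    rewrite -[in LHS](card_ord r) -sumr_const; apply: eq_bigr => k _.
    by rewrite (normsq_orthonormal_upto ou).
  by apply: cvg_sum => k _; exact: parseval_normsq.
have xcvg : (fun n => \sum_(j < r) \sum_(k < r) inner (w k) (v j) *
      \sum_(i < n) inner (w k) (e i) * inner (v j) (e i)) @ \oo -->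
    overlap v w r.
  apply: cvg_sum => j _; apply: cvg_sum => k _; rewrite expr2.
  by apply: cvgM; [exact: cvg_cst|exact: parseval].
have -> : 2 * (r%:R - overlap v w r) = r%:R - 2 * overlap v w r + r%:R by ring.
apply: cvg_trans (cvgD (cvgB (vcvg _ ov) (cvgM (cvg_cst (2 : R)) xcvg)) (vcvg _ ow)).
apply: near_eq_cvg; apply: nearW => n; rewrite !fctE /=.
have sw u : \sum_(k < r) \sum_(i < n) inner (u k) (e i) ^+ 2 =
    \sum_(i < n) \sum_(k < r) inner (e i) (u k) ^+ 2.
  rewrite exchange_big; apply: eq_bigr => i _; apply: eq_bigr => k _.
  by rewrite innerC.
have -> : \sum_(j < r) \sum_(k < r) inner (w k) (v j) *
      (\sum_(i < n) inner (w k) (e i) * inner (v j) (e i)) =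
    \sum_(i < n) inner (proj_span v r (e i)) (proj_span w r (e i)).
  under eq_bigr do under eq_bigr do rewrite mulr_sumr.
  under eq_bigr do rewrite exchange_big.
  rewrite exchange_big; apply: eq_bigr => i _.
  rewrite inner_suml; apply: eq_bigr => j _.
  rewrite inner_sumr; apply: eq_bigr => k _.
  by rewrite innerZl innerZr !(innerC (e i)) (innerC (v j) (w k)); ring.
rewrite !sw mulr_sumr -sumrB -big_split; apply: eq_bigr => i _ /=.
by rewrite normsqB !normsq_proj_span.
Qed.

(** The Hilbert-Schmidt inner product of D with the difference of the
    projections is the difference of the traces of D on the two spans. *)
Lemma trace_diff_cvg :
  (fun n => \sum_(i < n)
     inner (D (e i)) (proj_span v r (e i) - proj_span w r (e i))) @ \oo -->
  \sum_(k < r) inner (D (v k)) (v k) - \sum_(k < r) inner (D (w k)) (w k).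
Proof.
have tr u : (fun n => \sum_(k < r) \sum_(i < n)
      inner (D (u k)) (e i) * inner (u k) (e i)) @ \oo -->
    \sum_(k < r) inner (D (u k)) (u k).
  by apply: cvg_sum => k _; exact: parseval.
apply: cvg_trans (cvgB (tr v) (tr w)); apply: near_eq_cvg.
apply: nearW => n; rewrite !fctE /=.
rewrite ![\sum_(k < r) \sum_(i < n) _]exchange_big -sumrB.
apply: eq_bigr => i _ /=; rewrite innerBr !inner_sumr.
by congr (_ - _); apply: eq_bigr => k _;
  rewrite innerZr sD (innerC (e i)) (innerC (D _)) mulrC.
Qed.

Lemma excess_sq_le (h : R) :
  (forall n, \sum_(i < n) `|D (e i)| ^+ 2 <= h) ->
  excess A mu w r ^+ 2 <= h * (2 * (r%:R - overlap v w r)).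
Proof.
move=> Dh; apply: (@le_trans _ _ ((\sum_(k < r) inner (D (v k)) (v k)
   - \sum_(k < r) inner (D (w k)) (w k)) ^+ 2)).
  have x0 := excess_ge0 pA eA ow.
  have y0 := le_trans x0 excess_le_trace_diff.
  by rewrite ler_pXn2r ?nnegrE// excess_le_trace_diff.
apply: (ler_cvg_to (cvgM trace_diff_cvg trace_diff_cvg)
                   (cvgM (cvg_cst h) proj_diff_normsq_cvg)).
apply: nearW => n /=; rewrite -expr2.
apply: le_trans (cauchy_schwarz_sum _ _ _) _.
by apply: ler_wpM2r; [apply: sumr_ge0 => i _; exact: sqr_ge0|exact: Dh].
Qed.

End empirical_penalty.

(** By [excess_sq_le], x^2 <= 2 (r - tau) |D|^2 for the excess x.  The first bound
    uses tau >= 0; for the second, multiply by the gap g and use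
    g (r - tau) <= x to get g x^2 <= 2 |D|^2 x. *)
Lemma excess_le_penalty {R : realType} (H : hilbertType R) (A B : H -> H)
    (mu nu : nat -> R) (v w : nat -> H) (r : nat) :
  (exists e : nat -> H, orthonormal_basis e) -> (0 < r)%N ->
  positive_op A -> positive_op B ->
  ordered_eigenbasis A mu v -> ordered_eigenbasis B nu w ->
  ((excess A mu w r)%:E <= subspace_penalty r (mu r.-1 - mu r) (A \- B)%R)%E.
Proof.
move=> /onbP be r0 pA pB eA eB.
have ow : orthonormal_upto r w by case: eB => ? _ _ _; exact: orthonormalW.
have ov : orthonormal_upto r v by case: eA => ? _ _ _; exact: orthonormalW.
have gap0 : 0 <= mu r.-1 - mu r.
  by rewrite subr_ge0; case: eA => _ _ + _; apply; exact: leq_pred.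
have hsD0 : (0 <= hs_normsq (A \- B)%R)%E.
  by apply: nneseries_ge0 => i _ _; rewrite lee_fin sqr_ge0.
have x0 := excess_ge0 pA eA ow.
have gx := ky_fan pA eA ow.
have tau0 : 0 <= overlap v w r.
  by do 2!(apply: sumr_ge0 => ? _); exact: sqr_ge0.
rewrite /subspace_penalty /hs_norm.
(* If D is not Hilbert-Schmidt, both entries of the minimum are infinite. *)
case hsE : (hs_normsq (A \- B)%R) hsD0 => [h||] // hsD0; last first.
  rewrite /= gt0_muley ?lte_fin ?sqrtr_gt0 ?mulr_gt0 ?ltr0n// .
  case: eqP => [_|/eqP g0]; first by rewrite minxx leey.
  by rewrite gt0_muley// gt0_mulye ?lte_fin ?invr_gt0 ?lt_neqAle 1?eq_sym ?g0// minxx leey.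
have h0 : 0 <= h by rewrite -lee_fin.
have Dh n : \sum_(i < n) `|(A \- B) (onb H i)| ^+ 2 <= h.
  rewrite -lee_fin -hsE -sumEFin -(big_mkord xpredT (fun i => (`|(A \- B) (onb H i)| ^+ 2)%:E)).
  by apply: nneseries_lim_ge => i _ _; rewrite lee_fin sqr_ge0.
have xx := excess_sq_le r pA pB eA eB be Dh.
rewrite le_min; apply/andP; split.
  rewrite /= -EFinM lee_fin -sqrtrM ?mulr_ge0//.
  rewrite -(ger0_norm x0) -sqrtr_sqr ler_wsqrtr//; apply: le_trans xx _.
  rewrite mulrC; apply: ler_wpM2r => //; lra.
case: eqP => [_|/eqP g0]; first exact: leey.
rewrite -!EFinM lee_fin ler_pdivlMr; last by rewrite lt_neqAle eq_sym g0.
move: xx x0 gx gap0; set x := excess _ _ _ _; set g := _ - mu r.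
set s := r%:R - overlap v w r => xx x0 gx gap0.
have [->|xn0] := eqVneq x 0; first by rewrite mul0r mulr_ge0.
have xp : 0 < x by rewrite lt_neqAle eq_sym xn0.
rewrite -(ler_pM2l xp); have -> : x * (x * g) = x ^+ 2 * g by ring.
apply: (@le_trans _ _ (h * (2 * s) * g)); first exact: ler_wpM2r.
have -> : h * (2 * s) * g = 2 * h * (g * s) by ring.
rewrite [leRHS]mulrC; apply: ler_wpM2l => //; exact: mulr_ge0.
Qed.

(** * Hilbert-Schmidt operators and their adjoints *)

Section hilbert_schmidt_adjoint.
Context {R : realType}.
Implicit Types H K E Y : hilbertType R.

Lemma linear_bounded_cont H K (A : H -> K) (k : R) : linear A ->
  (forall x, `|A x| <= k * `|x|) -> continuous A.
Proof.
move=> lA Ak x; apply/cvgrPdist_lt => eps eps0.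
have k0 : 0 < `|k| + 1 by rewrite ltr_pwDr.
near=> z; rewrite -linB//.
have : `|x - z| < eps / (`|k| + 1).
  by near: z; apply: cvgr_dist_lt; rewrite ?divr_gt0.
rewrite ltr_pdivlMr// mulrC; apply: le_lt_trans; apply: le_trans (Ak _) _.
apply: ler_wpM2r => //; apply: le_trans (ler_norm k) _.
by rewrite lerDl.
Unshelve. all: by end_near. Qed.

Lemma positive_op_scale H (c : R) (A : H -> H) : 0 <= c -> positive_op A ->
  positive_op (fun x => c *: A x).
Proof.
move=> c0 [[lA cA] sA A0]; split.
- split; last by move=> x; apply: cvgZ; [exact: cvg_cst|exact: cA].
  by move=> a x y; rewrite lA scalerDr !scalerA mulrC.
- by move=> x y; rewrite innerZl innerZr sA.
- by move=> x; rewrite innerZl mulr_ge0.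
Qed.

Lemma positive_op_sum H I (s : seq I) (A : I -> H -> H) :
  (forall i, positive_op (A i)) -> positive_op (fun x => \sum_(i <- s) A i x).
Proof.
move=> pA; elim: s => [|i s [[lS cS] sS S0]].
  under eq_fun do rewrite big_nil.
  split; last by move=> x; rewrite inner0l.
    split; last by move=> x; exact: cvg_cst.
    by move=> a x y; rewrite scaler0 addr0.
  by move=> x y; rewrite inner0l inner0r.
under eq_fun do rewrite big_cons.
have [[lA cA] sA A0] := pA i.
split.
- split; last by move=> x; apply: cvgD; [exact: cA|exact: cS].
  by move=> a x y; rewrite lA lS scalerDr addrACA.
- by move=> x y; rewrite innerDl innerDr sA sS.
- by move=> x; rewrite innerDl addr_ge0.
Qed.

(** Both sides are the double sum of the squared matrix entries. *)
Lemma hs_dual H K (e : nat -> H) (f : nat -> K) (A : H -> K) (B : K -> H) :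
  orthonormal_basis e -> orthonormal_basis f ->
  (forall x y, inner (A x) y = inner x (B y)) ->
  (\sum_(i <oo) (`|A (e i)| ^+ 2)%:E = \sum_(j <oo) (`|B (f j)| ^+ 2)%:E)%E.
Proof.
move=> be bf AB.
transitivity (\sum_(i <oo) \sum_(j <oo) (inner (A (e i)) (f j) ^+ 2)%:E)%E.
  by apply: eq_eseriesr => i _; apply/esym/eseries_cvg; exact: parseval_normsq.
rewrite nneseries_interchange => [|i j]; last by rewrite lee_fin sqr_ge0.
apply: eq_eseriesr => j _; under eq_eseriesr do rewrite AB innerC.
by apply: eseries_cvg; exact: parseval_normsq.
Qed.

Section adjoint.
Variables (E Y : hilbertType R) (A : E -> Y).
Hypothesis be : orthonormal_basis (onb E).
Hypothesis hsA : hilbert_schmidt A.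
Let e := onb E.

Lemma hilbert_schmidt_bound :
  exists h, forall n, \sum_(i < n) `|A (e i)| ^+ 2 <= h.
Proof.
case: hsA => _ hs; exists (fine (hs_normsq A)) => n.
have hs0 : (0 <= hs_normsq A)%E.
  by apply: nneseries_ge0 => i _ _; rewrite lee_fin sqr_ge0.
rewrite -lee_fin fineK ?ge0_fin_numE// -sumEFin.
rewrite -(big_mkord xpredT (fun i => (`|A (e i)| ^+ 2)%:E)).
by apply: nneseries_lim_ge => i _ _; rewrite lee_fin sqr_ge0.
Qed.

(** In [adjointP] these coefficients define the adjoint of A; they are
    then its coordinates in the basis e, and the estimate bounds it. *)
Lemma coef_bound h y : (forall n, \sum_(i < n) `|A (e i)| ^+ 2 <= h) ->
  forall n, \sum_(i < n) inner y (A (e i)) ^+ 2 <= `|y| ^+ 2 * h.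
Proof.
move=> Ah n; apply: (@le_trans _ _ (`|y| ^+ 2 * \sum_(i < n) `|A (e i)| ^+ 2)).
  rewrite mulr_sumr; apply: ler_sum => i _.
  rewrite -exprMn -[leLHS]real_normK ?num_real//.
  by rewrite ler_pXn2r ?nnegrE ?mulr_ge0// cauchy_schwarz.
by apply: ler_wpM2l; rewrite ?sqr_ge0.
Qed.

(** The series of the <y, A e_i> e_i converges because the A e_i are square
    summable; its sum is the value at y of an adjoint. *)
Lemma adjointP x y : inner (A x) y = inner x (adjoint A y).
Proof.
suff : exists B : Y -> E, forall x y, inner (A x) y = inner x (B y).
  by move/(@xgetPex _ (fun=> 0)); exact.
have [[lA cA] _] := hsA; have [h Ah] := hilbert_schmidt_bound.
have [oe ce] := (orthonormal_basisP e).1 be.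
have cB z : cvgn (fun n => \sum_(i < n) inner z (A (e i)) *: e i).
  exact: (orthonormal_series_cvg (c := fun i => inner z (A (e i))) oe (coef_bound z Ah)).
pose B z := limn (fun n => \sum_(i < n) inner z (A (e i)) *: e i).
have eB z : (fun n => \sum_(i < n) inner z (A (e i)) *: e i) @ \oo --> B z.
  exact: cB.
exists B => a b.
have h1 : (fun n => inner (A (proj_span e n a)) b) @ \oo --> inner (A a) b.
  by apply: inner_cvg; exact: cvg_comp (ce a) (cA a).
rewrite [RHS]innerC; apply: cvg_unique h1 _ => //.
have := inner_cvg (y := a) (eB b); apply: cvg_trans.
apply: near_eq_cvg; apply: nearW => n; rewrite (lin_sum _ _ _ lA) !inner_suml.
by apply: eq_bigr => i _; rewrite linZ// !innerZl !(innerC b) (innerC a) mulrC.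
Qed.

Lemma adjoint_linear : linear (adjoint A).
Proof.
move=> a x y; apply: inner_inj => z.
by rewrite innerDl innerZl !(innerC _ z) -!adjointP innerDr innerZr.
Qed.

Lemma adjoint_continuous : continuous (adjoint A).
Proof.
have [h Ah] := hilbert_schmidt_bound.
have h0 : 0 <= h by have := Ah 0%N; rewrite big_ord0.
apply: (@linear_bounded_cont _ _ _ (Num.sqrt h)); first exact: adjoint_linear.
move=> y; rewrite -(@ler_pXn2r _ 2)// ?nnegrE ?mulr_ge0//.
rewrite exprMn sqr_sqrtr// mulrC.
apply: (@cvgr_to_le _ _ _ _ _ _ _ (parseval_normsq be (x := adjoint A y))).
apply: nearW => n; apply: le_trans (coef_bound y Ah n); apply: ler_sum => i _.
by rewrite innerC -adjointP innerC.
Qed.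

Lemma inner_adjoint_comp x y :
  inner (adjoint A (A x)) y = inner (A x) (A y).
Proof. by rewrite innerC -adjointP innerC. Qed.

Lemma inner_comp_adjoint x y :
  inner (A (adjoint A x)) y = inner (adjoint A x) (adjoint A y).
Proof. exact: adjointP. Qed.

Lemma adjoint_comp_positive : positive_op (fun x => adjoint A (A x)).
Proof.
have [[lA cA] _] := hsA; split.
- split; first by move=> a x y; rewrite lA adjoint_linear.
  by move=> x; apply: (@continuous_comp _ _ _ A (adjoint A)); [exact: cA|exact: adjoint_continuous].
- by move=> x y; rewrite inner_adjoint_comp (innerC x) inner_adjoint_comp innerC.
- by move=> x; rewrite inner_adjoint_comp inner_normE sqr_ge0.
Qed.

Lemma comp_adjoint_positive : positive_op (fun x => A (adjoint A x)).
Proof.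
have [[lA cA] _] := hsA; split.
- split; first by move=> a x y; rewrite adjoint_linear lA.
  by move=> x; apply: (@continuous_comp _ _ _ (adjoint A) A); [exact: adjoint_continuous|exact: cA].
- by move=> x y; rewrite inner_comp_adjoint (innerC x) inner_comp_adjoint innerC.
- by move=> x; rewrite inner_comp_adjoint inner_normE sqr_ge0.
Qed.

End adjoint.
End hilbert_schmidt_adjoint.

(** * Averaging over the random operator *)

Section measurability.
Context {R : realType}.
Implicit Types X H K Y : hilbertType R.

Lemma continuous_measurable_comp X Y (g : Y -> R) (f : X -> Y) :
  continuous g ->
  measurable_fun [set: borel X] (f : borel X -> borel Y) ->
  measurable_fun [set: borel X] ((g \o f) : borel X -> measurableTypeR R).
Proof.
move=> cg mf; apply: (measurability _ (@RGenOpens.measurableE R)).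
move=> _ [_ [a [b ->]] <-]; rewrite setTI comp_preimage -[X in measurable X]setTI.
apply: mf => //; apply: sub_gen_smallest.
by apply: open_comp => [y _|]; [exact: cg|exact: interval_open].
Qed.

Lemma measurable_normsq X Y (f : X -> Y) :
  measurable_fun [set: borel X] (f : borel X -> borel Y) ->
  measurable_fun [set: borel X] (fun x : borel X => (`|f x| ^+ 2)%:E : \bar R).
Proof.
move=> mf; apply/measurable_EFinP; apply: measurable_funX.
by apply: continuous_measurable_comp mf; exact: norm_continuous.
Qed.

Lemma measurable_innersq X Y (f : X -> Y) y :
  measurable_fun [set: borel X] (f : borel X -> borel Y) ->
  measurable_fun [set: borel X] (fun x : borel X => (inner (f x) y ^+ 2)%:E : \bar R).
Proof.
move=> mf; apply/measurable_EFinP; apply: measurable_funX.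
by apply: (continuous_measurable_comp (g := fun z => inner z y)) mf; exact: inner_continuous.
Qed.

End measurability.

Section mean_error.
Context {R : realType} (X H : hilbertType R).
Variables (gamma : probability (borel X) R) (T : X -> H -> H) (M : H -> H).
Hypothesis pT : forall x, positive_op (T x).
Hypothesis mT : forall a,
  measurable_fun [set: borel X] (fun x : borel X => (inner (T x a) a)%:E : \bar R).
Hypothesis meanT : operator_mean gamma T M.

Lemma operator_mean_positive : positive_op M.
Proof.
case: meanT => bM MT; split=> // [a b|a].
  apply: EFin_inj; rewrite (innerC a) !MT.
  by apply: eq_integral => x _; case: (pT x) => _ sT _; rewrite sT innerC.
rewrite -lee_fin MT; apply: integral_ge0 => x _.
by case: (pT x) => _ _ T0; rewrite lee_fin.
Qed.

(** Tonelli, the terms being nonnegative. *)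
Lemma integral_trace (b : nat -> H) :
  (\int[gamma]_x \sum_(i <oo) (inner (T x (b i)) (b i))%:E =
   \sum_(i <oo) (inner (M (b i)) (b i))%:E)%E.
Proof.
rewrite integral_nneseries//; last first.
  by move=> n x _; case: (pT x) => _ _ T0; rewrite lee_fin.
by case: meanT => _ MT; apply: eq_eseriesr => i _; rewrite MT.
Qed.

(* err stands for either reconstruction error; [errE] is asked only for
   projections of the form [proj_span], which are self-adjoint. *)
Variables (mu : nat -> R) (v e : nat -> H) (err : (H -> H) -> \bar R) (r : nat).
Hypothesis be : orthonormal_basis e.
Hypothesis eM : ordered_eigenbasis M mu v.
Hypothesis errE : forall w, err (proj_span w r) =
  (\int[gamma]_x \sum_(i <oo) (inner (T x (e i - proj_span w r (e i)))
                                     (e i - proj_span w r (e i)))%:E)%E.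

Lemma reconstruction_error w : orthonormal_upto r w ->
  err (proj_span w r) =
  (\sum_(r <= i <oo) (mu i)%:E + (excess M mu w r)%:E)%E.
Proof.
move=> ow; rewrite errE integral_trace.
exact: trace_residual operator_mean_positive eM be ow.
Qed.

Lemma optimal_projection :
  [/\ projections r (proj_span v r),
      forall Q, projections r Q -> (err (proj_span v r) <= err Q)%E &
      err (proj_span v r) = (\sum_(r <= i <oo) (mu i)%:E)%E].
Proof.
have ov : orthonormal_upto r v by case: eM => ov _ _ _; exact: orthonormalW.
have vE : err (proj_span v r) = (\sum_(r <= i <oo) (mu i)%:E)%E.
  by rewrite reconstruction_error// (excess_eigenbasis _ eM) adde0.
split=> // [|Q /projectionsE[w ow ->]]; first exact: proj_span_projections.
rewrite vE reconstruction_error//; apply: leeDl; rewrite lee_fin.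
exact: excess_ge0 operator_mean_positive eM ow.
Qed.

Lemma empirical_projection N (x : 'I_N -> X) (nu : nat -> R) (w : nat -> H) :
  (0 < r)%N -> ordered_eigenbasis (sample_mean T x) nu w ->
  (err (proj_span w r) <= \sum_(r <= i <oo) (mu i)%:E +
    subspace_penalty r (mu r.-1 - mu r) (M \- sample_mean T x)%R)%E.
Proof.
move=> r0 ew; have ow : orthonormal_upto r w.
  by case: ew => ow _ _ _; exact: orthonormalW.
rewrite reconstruction_error//; apply: leeD => //.
have pS : positive_op (sample_mean T x).
  apply: positive_op_scale; first by rewrite invr_ge0.
  by apply: positive_op_sum => k; exact: pT.
apply: excess_le_penalty operator_mean_positive pS eM ew => //.
by exists e.
Qed.

End mean_error.

Section gram_operators.
Context {R : realType} {X E Y : hilbertType R}.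
Variables (gamma : probability (borel X) R) (DF : X -> E -> Y).
Hypothesis bE : orthonormal_basis (onb E).
Hypothesis bY : orthonormal_basis (onb Y).
Hypothesis mDF : forall e, measurable_fun [set: borel X]
  ((fun x => DF x e) : borel X -> borel Y).
Hypothesis hsDF : forall x, hilbert_schmidt (DF x).

Lemma input_gram_measurable a : measurable_fun [set: borel X]
  (fun x : borel X => (inner (input_gram DF x a) a)%:E : \bar R).
Proof.
have -> : (fun x => (inner (input_gram DF x a) a)%:E) = (fun x => (`|DF x a| ^+ 2)%:E).
  by apply/funext => x; rewrite inner_adjoint_comp// inner_normE.
exact: measurable_normsq.
Qed.

(** Measurability of the adjoint is recovered from that of A by Parseval:
    |A^* b|^2 is the sum of the <A e_i, b>^2. *)
Lemma output_gram_measurable b : measurable_fun [set: borel X]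
  (fun x : borel X => (inner (output_gram DF x b) b)%:E : \bar R).
Proof.
have -> : (fun x => (inner (output_gram DF x b) b)%:E) =
    (fun x => \sum_(i <oo) (inner (DF x (onb E i)) b ^+ 2)%:E)%E.
  apply/funext => x; rewrite inner_comp_adjoint// inner_normE.
  under eq_eseriesr do rewrite adjointP// innerC.
  by apply/esym/eseries_cvg; exact: parseval_normsq.
apply: ge0_emeasurable_sum => [i x _ _|i _]; first by rewrite lee_fin sqr_ge0.
exact: measurable_innersq.
Qed.

Lemma input_errorE Q : input_error gamma DF Q =
  (\int[gamma]_x \sum_(i <oo) (inner (input_gram DF x (onb E i - Q (onb E i)))
                                     (onb E i - Q (onb E i)))%:E)%E.
Proof.
apply: eq_integral => x _; apply: eq_eseriesr => i _.
by rewrite inner_adjoint_comp// inner_normE.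
Qed.

(** The adjoint of (I - Q) A is A^* (I - Q), with the same Hilbert-Schmidt
    norm. *)
Lemma output_errorE Q : self_adjoint Q -> output_error gamma DF Q =
  (\int[gamma]_x \sum_(i <oo) (inner (output_gram DF x (onb Y i - Q (onb Y i)))
                                     (onb Y i - Q (onb Y i)))%:E)%E.
Proof.
move=> sQ; apply: eq_integral => x _.
under [RHS]eq_eseriesr do rewrite inner_comp_adjoint// inner_normE.
apply: (hs_dual (A := fun a => DF x a - Q (DF x a))
  (B := fun b => adjoint (DF x) (b - Q b))) => // a b.
by rewrite innerBl sQ -innerBr adjointP.
Qed.

End gram_operators.

(* Eigenpairs are numbered from 0: mu_i is  mu i.-1. *)
Theorem proposition22
  (R : realType) (X Y E : hilbertType R)
  (hX : infinite_dim X) (sepX : separable X)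
  (hY : infinite_dim Y) (sepY : separable Y)
  (gamma : probability (borel X) R) (C : X -> X)
  (hgamma : centered_gaussian gamma C) (Cinj : injective C)
  (S : X -> X) (hS : is_sqrt_op S C)
  (iota : E -> X) (hE : cameron_martin S iota)
  (r : nat) (r_gt0 : (0 < r)%N)
  (F : X -> Y) (DF : X -> E -> Y) (hF : H1_gamma gamma iota F DF)
  (HX : E -> E) (hHX : operator_mean gamma (input_gram DF) HX)
  (HY : Y -> Y) (hHY : operator_mean gamma (output_gram DF) HY)
  (mu : nat -> R) (v : nat -> E) (hv : ordered_eigenbasis HX mu v)
  (lam : nat -> R) (u : nat -> Y) (hu : ordered_eigenbasis HY lam u)
  (vC : forall i, range C (iota (v i)))
  (d : measure_display) (Omega : measurableType d) (P : probability Omega R)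
  (N : nat) (N_gt0 : (0 < N)%N)
  (xi : 'I_N -> Omega -> X) (hxi : iid_samples gamma P xi)
  (hmu : Omega -> nat -> R) (hatv : Omega -> nat -> E)
  (hhatv : {ae P, forall om, ordered_eigenbasis
     (sample_mean (input_gram DF) (xi ^~ om)) (hmu om) (hatv om)})
  (hlam : Omega -> nat -> R) (hatu : Omega -> nat -> Y)
  (hhatu : {ae P, forall om, ordered_eigenbasis
     (sample_mean (output_gram DF) (xi ^~ om)) (hlam om) (hatu om)})
  (hatvC : {ae P, forall om, forall i, range C (iota (hatv om i))}) :
  [/\ [/\ projections r (proj_span v r),
          forall Q, projections r Q ->
            (input_error gamma DF (proj_span v r) <= input_error gamma DF Q)%E &
          input_error gamma DF (proj_span v r)
            = (\sum_(r <= i <oo) (mu i)%:E)%E],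
      [/\ projections r (proj_span u r),
          forall Q, projections r Q ->
            (output_error gamma DF (proj_span u r)
               <= output_error gamma DF Q)%E &
          output_error gamma DF (proj_span u r)
            = (\sum_(r <= i <oo) (lam i)%:E)%E],
      {ae P, forall om,
        (input_error gamma DF (proj_span (hatv om) r) <=
          \sum_(r <= i <oo) (mu i)%:E +
          subspace_penalty r (mu r.-1 - mu r)
            (HX \- sample_mean (input_gram DF) (xi ^~ om))%R)%E} &
      {ae P, forall om,
        (output_error gamma DF (proj_span (hatu om) r) <=
          \sum_(r <= i <oo) (lam i)%:E +
          subspace_penalty r (lam r.-1 - lam r)
            (HY \- sample_mean (output_gram DF) (xi ^~ om))%R)%E}].
Proof.
have bX := exists_orthonormal_basis hX sepX.
have bY := onbP (exists_orthonormal_basis hY sepY).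
have bE := onbP (cameron_martin_basis hE bX).
have [_ mDF hsDF _] := hF.
have pI x : positive_op (input_gram DF x) by exact: adjoint_comp_positive.
have pO x : positive_op (output_gram DF x) by exact: comp_adjoint_positive.
have mI := input_gram_measurable bE mDF hsDF.
have mO := output_gram_measurable bE mDF hsDF.
have eI w := input_errorE gamma bE hsDF (proj_span w r).
have eO w := output_errorE gamma bE bY hsDF (@proj_span_self_adjoint _ _ w r).
split.
- exact: (optimal_projection pI mI hHX bE hv eI).
- exact: (optimal_projection pO mO hHY bY hu eO).
- apply: filterS hhatv => om.
  exact: (empirical_projection pI mI hHX bE hv eI).
- apply: filterS hhatu => om.
  exact: (empirical_projection pO mO hHY bY hu eO).
Qed.
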